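(* Let $\langle \mathcal{N},\mathcal{D},\theta\rangle$ be a $d$-dimensional sandpile model with complete neighborhood and let $r=\max\{|v|_\infty : v\in\mathcal{N}\}$. There is an absolute constant $K$ such that for every $n\ge1$ and every configuration $c$ supported on $\{0,\dots,n-1\}^d$ with $c(x)<2\theta$ for all $x$, the sequence $c,F(c),F^2(c),\dots$ reaches a stable configuration within at most $(2d\theta r n)^{K d^2}$ time steps (a polynomial in the size of $c$).
   Context: A $d$-dimensional sandpile model is a triple $\langle \mathcal{N},\mathcal{D},\theta\rangle$ with $\mathcal{N}$ a finite subset of $\mathbb{Z}^d\setminus\{0^d\}$, $\mathcal{D}:\mathcal{N}\to\mathbb{N}_+$, $\theta=\sum_{v\in\mathcal{N}}\mathcal{D}(v)$; completeness means that nonnegative integer linear combinations of elements of $\mathcal{N}$ give all of $\mathbb{Z}^d$. Configurations are maps $c:\mathbb{Z}^d\to\mathbb{N}$. The global rule is $F(c)(x)=c(x)-\theta\,H(c(x)-\theta)+\sum_{v\in\mathcal{N}}\mathcal{D}(v)H(c(x+v)-\theta)$ where $H(m)=1$ if $m\ge0$ and $0$ otherwise. A configuration is stable if $c(x)<\theta$ for all $x$ (stable configurations are fixed points of $F$). *)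

(* Defs.v *)
From mathcomp Require Import all_boot all_order all_algebra.
From mathcomp Require Import finmap.

Set Implicit Arguments.
Unset Strict Implicit.
Unset Printing Implicit Defensive.

Import Order.TTheory GRing.Theory Num.Theory.
Local Open Scope ring_scope.

Record sandpile (d : nat) := Sandpile {
  nbh : {fset 'rV[int]_d};
  nbh_neq0 : 0 \notin nbh;
  distr : nbh -> nat;
  distr_gt0 : forall v : nbh, (0 < distr v)%N
}.

Definition configuration (d : nat) := 'rV[int]_d -> nat.

Definition theta (d : nat) (M : sandpile d) : nat :=
  (\sum_(v : nbh M) distr v)%N.

Definition complete (d : nat) (M : sandpile d) : Prop :=
  forall x : 'rV[int]_d,
    exists a : nbh M -> nat, x = \sum_(v : nbh M) val v *+ a v.

Definition norm_inf (d : nat) (x : 'rV[int]_d) : nat :=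
  (\max_(i < d) `|x ord0 i|)%N.

Definition radius (d : nat) (M : sandpile d) : nat :=
  (\max_(v : nbh M) norm_inf (val v))%N.

Definition heaviside (m : int) : nat := if 0 <= m then 1%N else 0%N.

(* The natural-number subtraction never truncates: the factor [heaviside _]
   vanishes unless [theta M <= c x]. *)
Definition global_rule (d : nat) (M : sandpile d) (c : configuration d) :
    configuration d :=
  fun x =>
    (c x - theta M * heaviside ((c x)%:Z - (theta M)%:Z)
     + \sum_(v : nbh M)
         distr v * heaviside ((c (x + val v)%R)%:Z - (theta M)%:Z))%N.

Definition stable (d : nat) (M : sandpile d) (c : configuration d) : Prop :=
  forall x, (c x < theta M)%N.

Definition supported_on_cube (d n : nat) (c : configuration d) : Prop :=
  forall x, c x <> 0%N -> forall i : 'I_d, 0 <= x ord0 i < n%:Z.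

(* Main.v *)
(**
Completeness yields a nonempty word over the neighbourhood whose letters sum to 0.
Repeating its letters in a balanced order gives an endless walk within distance
[2 #|nbh| r] of its start. Suppose that [x] has toppled before time [t] and follow
such a walk backwards from [x]: a visited site which holds no grain at time [t] must
have toppled after the previous site of the walk sent it a grain. Toppling times
cannot increase forever, so at time [t] there is a grain near [x].

Grains leave the cube by steps of length at most [r], hence a grain far away forces
a toppled site, and then a grain, in each of many disjoint shells. As the number
[N] of grains does not grow, all grains stay within a distance polynomial in [N].

Finally, some potential (linear, or the squared norm if the drift vanishes)
increases by at least 1 with each toppling while remaining polynomially bounded;
this bounds the number of topplings, hence of steps before stability.
*)
From HB Require Import structures.
Require Import Defs.
From mathcomp Require Import all_boot all_order all_algebra.
From mathcomp Require Import finmap zify ring.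

Set Implicit Arguments.
Unset Strict Implicit.
Unset Printing Implicit Defensive.

Import Order.TTheory GRing.Theory Num.Theory.

Section NormInf.
Local Open Scope ring_scope.
Variable d : nat.
Implicit Types x y : 'rV[int]_d.

Lemma norm_inf_leP x b :
  reflect (forall i, (`|x ord0 i| <= b)%N) (norm_inf x <= b)%N.
Proof. by apply: (iffP (bigmax_leqP _ _ _)) => [le_b i|le_b i _]; apply: le_b. Qed.

Lemma norm_inf_ge x i : (`|x ord0 i| <= norm_inf x)%N.
Proof. exact/norm_inf_leP. Qed.

Lemma norm_inf_eq0 x : (norm_inf x == 0%N) = (x == 0).
Proof.
rewrite -leqn0; apply/norm_inf_leP/eqP => [x0|-> i]; last by rewrite mxE.
by apply/rowP => i; rewrite mxE; apply/eqP; rewrite -absz_eq0 -leqn0.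
Qed.

Lemma norm_infZ (k : int) x : norm_inf (k *: x) = (`|k| * norm_inf x)%N.
Proof.
rewrite /norm_inf (big_morph (muln `|k|) (maxnMr _) (muln0 _)).
by apply: eq_bigr => i _; rewrite mxE abszM.
Qed.

Lemma norm_infN x : norm_inf (- x) = norm_inf x.
Proof. by rewrite -scaleN1r norm_infZ mul1n. Qed.

Lemma norm_infD x y : (norm_inf (x + y) <= norm_inf x + norm_inf y)%N.
Proof.
apply/norm_inf_leP => i; rewrite mxE.
apply: leq_trans (leq_add (norm_inf_ge x i) (norm_inf_ge y i)).
by rewrite -lez_nat PoszD !abszE ler_normD.
Qed.

Lemma norm_inf_sum (I : Type) (s : seq I) (u : I -> 'rV[int]_d) :
  (norm_inf (\sum_(i <- s) u i)%R <= \sum_(i <- s) norm_inf (u i))%N.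
Proof.
elim/big_rec2: _ => [|i m x _ le_xm]; first by rewrite leqn0 norm_inf_eq0.
by apply: leq_trans (norm_infD _ _) _; rewrite leq_add2l.
Qed.

End NormInf.

Section Cube.
Local Open Scope ring_scope.
Variable d : nat.

Definition cube (lo : int) (n : nat) : seq 'rV[int]_d :=
  [seq \row_j (lo + (A ord0 j)%:Z) | A : 'rV['I_n]_d].

Lemma size_cube lo n : size (cube lo n) = (n ^ d)%N.
Proof. by rewrite size_map -cardE card_mx card_ord mul1n. Qed.

Lemma uniq_cube lo n : uniq (cube lo n).
Proof.
rewrite map_inj_uniq ?enum_uniq // => A B /rowP eqAB; apply/rowP => j.
by apply/val_inj; have := eqAB j; rewrite !mxE => /addrI[].
Qed.

Lemma mem_cube lo n (x : 'rV[int]_d) :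
  (forall j, lo <= x ord0 j < lo + n%:Z) -> x \in cube lo n.
Proof.
move=> xP; have lt_n j : (`|(x ord0 j - lo)%R| < n)%N by have := xP j; lia.
apply/mapP; exists (\row_j Ordinal (lt_n j)); first by rewrite mem_enum.
apply/rowP => j; have /andP[le_lo _] := xP j.
by rewrite !mxE gez0_abs ?subr_ge0 // subrKC.
Qed.

End Cube.

Section DotProduct.
Local Open Scope ring_scope.
Variable d : nat.

Definition dot (R : pzRingType) (x y : 'rV[R]_d) : R :=
  \sum_j x ord0 j * y ord0 j.

Lemma dotBr (R : pzRingType) (x : 'rV[R]_d) : {morph dot x : y z / y - z}.
Proof.
by move=> y z; rewrite -sumrB; apply: eq_bigr => j _; rewrite !mxE mulrBr.
Qed.

HB.instance Definition _ (R : pzRingType) (x : 'rV[R]_d) :=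
  GRing.isZmodMorphism.Build _ _ (dot x) (dotBr x).

Lemma dotC (R : comPzRingType) (x y : 'rV[R]_d) : dot x y = dot y x.
Proof. by apply: eq_bigr => j _; rewrite mulrC. Qed.

Lemma dot_gt0 (R : realDomainType) (x : 'rV[R]_d) : x != 0 -> 0 < dot x x.
Proof.
move=> x_neq0; have [j xj_neq0] : exists j, x ord0 j != 0.
  apply/existsP; apply: contraNT x_neq0 => /existsPn x_eq0; apply/eqP/rowP => j.
  by rewrite mxE; apply/eqP/negbNE.
rewrite /dot (bigD1 j) //= ltr_pwDl ?sumr_ge0 // => [|i _]; rewrite -expr2.
  by rewrite exprn_even_gt0 ?xj_neq0 ?orbT.
exact: sqr_ge0.
Qed.

Lemma dot_norm_inf_le (x y : 'rV[int]_d) :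
  (`|dot x y| <= d * (norm_inf x * norm_inf y))%N.
Proof.
rewrite -lez_nat abszE; apply: le_trans (ler_norm_sum _ _ _) _.
apply: (@le_trans _ _ (\sum_(j < d) (norm_inf x * norm_inf y)%:Z)).
  apply: ler_sum => j _; rewrite normrM -!abszE -PoszM lez_nat.
  by rewrite leq_mul ?norm_inf_ge.
by rewrite sumr_const card_ord -mulr_natl natz.
Qed.

End DotProduct.

Lemma sum_count_mem (I : finType) (s : seq I) : \sum_v count_mem v s = size s.
Proof.
rewrite -sum1_size [RHS](partition_big id xpredT) //=.
by apply: eq_bigr => v _; rewrite sum1_count.
Qed.

Lemma sumr_count_mem (I : finType) (V : nmodType) (u : I -> V) (s : seq I) :
  (\sum_v u v *+ count_mem v s = \sum_(v <- s) u v)%R.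
Proof.
rewrite [RHS](partition_big id xpredT) //=; apply: eq_bigr => v _.
rewrite (eq_bigr (fun=> u v)) => [|i /eqP -> //].
by rewrite big_const_seq -Monoid.iteropE.
Qed.

Section BalancedWords.
Variables (I : finType) (l : seq I).
Hypothesis l_neq0 : 0 < size l.

(* The excess of [count_mem v s] over its ideal value, proportional to
   [count_mem v l], is less than 1. *)
Definition balanced (s : seq I) : Prop :=
  forall v, size l * count_mem v s < size s * count_mem v l + size l.

Lemma balanced_nil : balanced [::].
Proof. by move=> v; rewrite muln0. Qed.

Lemma balanced_rcons s : balanced s -> exists w, balanced (rcons s w).
Proof.
move=> bal_s.
have [w lt_w|full] :=
    pickP (fun w => size l * count_mem w s < (size s).+1 * count_mem w l).
  exists w => v; rewrite size_rcons -cats1 count_cat /= addn0.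
  have [<-|_] := eqVneq w v; first by rewrite addn1 mulnSr ltn_add2r.
  by rewrite addn0 mulSn -addnA (leq_trans (bal_s v)) ?leq_addl.
have : (size s).+1 * size l <= size l * size s.
  rewrite -!sum_count_mem !big_distrr /=; apply: leq_sum => v _.
  by rewrite !sum_count_mem leqNgt full.
by nia.
Qed.

Local Open Scope ring_scope.

Lemma norm_inf_balanced d (u : I -> 'rV[int]_d) (r : nat) s :
    (forall v, norm_inf (u v) <= r)%N -> \sum_(v <- l) u v = 0 -> balanced s ->
  (norm_inf (\sum_(v <- s) u v)%R <= 2 * #|I| * r)%N.
Proof.
move=> u_le sum_l bal_s.
pose excess v : int := (size l * count_mem v s)%:R - (size s * count_mem v l)%:R.
have sum_excess : \sum_v excess v = 0.
  by rewrite sumrB -!natr_sum -!big_distrr /= !sum_count_mem mulnC subrr.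
have excess_le : (\sum_v `|excess v| <= 2 * #|I| * size l)%N.
  rewrite -lez_nat (big_morph Posz PoszD (erefl _)).
  apply: (@le_trans _ _ (\sum_v ((2 * size l)%N%:Z - excess v))).
    by apply: ler_sum => v _; have := bal_s v; rewrite /excess !natz; lia.
  rewrite sumrB sum_excess subr0 sumr_const -mulr_natl natz -PoszM.
  by rewrite lez_nat mulnCA mulnA.
have sum_s : (size l)%:Z *: \sum_(v <- s) u v = \sum_v excess v *: u v.
  under [RHS]eq_bigr do rewrite scalerBl !natrM -!scalerA !scaler_nat.
  by rewrite sumrB !sumrMnl !sumr_count_mem sum_l mul0rn subr0 -scaler_nat natz.
rewrite -(leq_pmul2l l_neq0) -[X in (X * _)%N]absz_nat -norm_infZ sum_s.
apply: leq_trans (norm_inf_sum _ _) _.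
apply: (@leq_trans (\sum_v `|excess v| * r)%N).
  by apply: leq_sum => v _; rewrite norm_infZ leq_mul2l u_le orbT.
by rewrite -big_distrl /= mulnA leq_mul2r mulnC excess_le orbT.
Qed.

End BalancedWords.

Lemma leq_sum_subset (T : eqType) (l l' : seq T) (F : T -> nat) :
    uniq l -> uniq l' -> {subset l <= l'} ->
  \sum_(x <- l) F x <= \sum_(x <- l') F x.
Proof. exact: (uniq_sub_le_big leqnn (fun x y => leq_addr y x)). Qed.

Section Mass.
Variable T : eqType.
Implicit Types (c : T -> nat) (l : seq T).

Definition mass_le c (N : nat) : Prop :=
  forall l, uniq l -> \sum_(x <- l) c x <= N.

Lemma mass_le_bounded c m l :
    (forall x, c x <= m) -> (forall x, 0 < c x -> x \in l) ->
  mass_le c (m * size l).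
Proof.
move=> c_le c_supp l' uniq_l'.
apply: (@leq_trans (\sum_(x <- l' | 0 < c x) m)).
  by rewrite [leqRHS]big_mkcond; apply: leq_sum => x _; case: posnP => // ->.
rewrite big_const_seq iter_addn_0 leq_mul2l -size_filter; apply/orP; right.
apply: uniq_leq_size => [|x]; first exact: filter_uniq.
by rewrite mem_filter => /andP[/c_supp].
Qed.

Lemma size_le_mass c N l :
  mass_le c N -> uniq l -> all (fun x => 0 < c x) l -> size l <= N.
Proof.
move=> mass_c uniq_l /allP c_gt0; apply: leq_trans (mass_c l uniq_l).
by rewrite -sum1_size !big_seq; apply: leq_sum.
Qed.

End Mass.

Section Potential.
Local Open Scope ring_scope.
Variables (T : eqType) (S : seq T).

Definition potential (V : zmodType) (phi : T -> V) (c : T -> nat) : V :=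
  \sum_(x <- S) phi x *+ c x.

Lemma normr_potential_le (R : numDomainType) (phi : T -> R) c N G :
    uniq S -> mass_le c N -> {in S, forall x, `|phi x| <= G%:R} ->
  `|potential phi c| <= (N * G)%:R.
Proof.
move=> uniq_S mass_c phi_le; apply: le_trans (ler_norm_sum _ _ _) _.
apply: (@le_trans _ _ (\sum_(x <- S) G%:R *+ c x)).
  by rewrite !big_seq; apply: ler_sum => x xS; rewrite normrMn lerMn2r phi_le ?orbT.
by rewrite sumrMnr -mulrnA mulnC ler_nat leq_mul2r mass_c ?orbT.
Qed.

End Potential.

Lemma uniq_points_in_shells (T : eqType) (f : T -> nat) (P : pred T) m W N :
    (forall j, j < N -> exists2 y, P y & m + j * W <= f y < m + j.+1 * W) ->
  exists2 l, uniq l /\ size l = N & all (fun y => P y && (f y < m + N * W)) l.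
Proof.
elim: N => [|N IHN] shell; first by exists [::].
have [j lt_jN|l [uniq_l size_l] /allP lP] := IHN; first by apply: shell; exact: ltnW.
have [y Py /andP[le_y lt_y]] := shell N (ltnSn N).
exists (y :: l); rewrite /= ?size_l ?Py ?lt_y /=.
  by rewrite uniq_l andbT; split=> //; apply/negP => /lP; rewrite ltnNge le_y andbF.
by apply/allP => z /lP /andP[-> lt_z] /=; rewrite mulSn; lia.
Qed.

Lemma sumr_translate (U : zmodType) (V : nmodType) (S : seq U) (h : U -> V) (v : U) :
    uniq S -> (forall y, h y != 0%R -> y \in S /\ (y - v)%R \in S) ->
  (\sum_(x <- S) h (x + v) = \sum_(y <- S) h y)%R.
Proof.
move=> uniq_S h_supp; rewrite -(big_map (fun x => x + v)%R xpredT h).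
have sum_support (l : seq U) : (\sum_(y <- l) h y = \sum_(y <- l | h y != 0) h y)%R.
  by rewrite [RHS]big_mkcond; apply: eq_bigr => y _; case: eqP.
rewrite [LHS]sum_support [RHS]sum_support -[LHS]big_filter -[RHS]big_filter.
apply: perm_big; apply: uniq_perm.
- by rewrite filter_uniq // map_inj_uniq //; exact: addIr.
- exact: filter_uniq.
move=> y; rewrite !mem_filter; have [//|/h_supp[-> yv_in_S] /=] := eqVneq (h y) 0%R.
by apply/mapP; exists (y - v)%R; rewrite ?subrK.
Qed.

Section Sandpile.
Local Open Scope ring_scope.
Variables (d : nat) (M : sandpile d).
Implicit Types (c : configuration d) (x y : 'rV[int]_d) (v w : nbh M).
Local Notation state c t := (iter t (global_rule M) c).

Definition supported_in_ball (n : nat) c : Prop :=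
  forall y, (0 < c y -> norm_inf y < n)%N.

Definition topples c x : bool := (theta M <= c x)%N.

Lemma global_ruleE c x :
  global_rule M c x = (c x - theta M * topples c x
     + \sum_(v : nbh M) distr v * topples c (x + val v)%R)%N.
Proof.
have heavisideE (m : nat) : heaviside (m%:Z - (theta M)%:Z) = (theta M <= m)%N.
  by rewrite /heaviside subr_ge0 lez_nat; case: leq.
by rewrite /global_rule heavisideE; under eq_bigr do rewrite heavisideE.
Qed.

Lemma theta_topples_le c x : (theta M * topples c x <= c x)%N.
Proof. by have [] := boolP (topples c x); rewrite ?muln0 ?muln1. Qed.

Lemma radius_ge v : (norm_inf (val v) <= radius M)%N.
Proof. exact: (@leq_bigmax _ (fun v : nbh M => norm_inf (val v))). Qed.

Lemma nbh_val_neq0 v : val v != 0.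
Proof. by apply: contraNneq (nbh_neq0 M) => <-; exact: valP. Qed.

Lemma card_nbh_le : (#|{: nbh M}| <= theta M)%N.
Proof. by rewrite -sum1_card; apply: leq_sum => v _; exact: distr_gt0. Qed.

Lemma global_rule_ge c x : ~~ topples c x -> (c x <= global_rule M c x)%N.
Proof.
by move=> /negbTE stable_x; rewrite global_ruleE stable_x muln0 subn0 leq_addr.
Qed.

Lemma global_rule_gt0 c x v : topples c x -> (0 < global_rule M c (x - val v)%R)%N.
Proof.
move=> top_x; rewrite global_ruleE (bigD1 v) //= subrK top_x muln1.
by have := distr_gt0 v; lia.
Qed.

Lemma mass_le_global_rule c N : mass_le c N -> mass_le (global_rule M c) N.
Proof.
move=> mass_c l uniq_l.
pose l' := undup (l ++ [seq x + val v | x <- l, v <- enum {: nbh M}]).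
have sub_l : {subset l <= l'} by move=> x xl; rewrite mem_undup mem_cat xl.
have received v :
    (\sum_(x <- l) topples c (x + val v)%R <= \sum_(y <- l') topples c y)%N.
  rewrite -(big_map (fun x => x + val v)%R xpredT (fun y => topples c y : nat)).
  apply: leq_sum_subset (undup_uniq _) _.
    by rewrite map_inj_uniq //; exact: addIr.
  move=> _ /mapP[x xl ->]; rewrite mem_undup mem_cat; apply/orP; right.
  by apply/allpairsP; exists (x, v); rewrite mem_enum.
apply: leq_trans (mass_c l' (undup_uniq _)).
under eq_bigr do rewrite global_ruleE.
rewrite big_split exchange_big /=.
have -> : (\sum_(y <- l') c y = \sum_(y <- l') (c y - theta M * topples c y)
    + \sum_(v : nbh M) distr v * \sum_(y <- l') topples c y)%N.
  rewrite -big_distrl big_distrr -big_split /=.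
  by apply: eq_bigr => y _; rewrite subnK ?theta_topples_le.
apply: leq_add; last first.
  by apply: leq_sum => v _; rewrite -big_distrr leq_mul2l received orbT.
exact: leq_sum_subset uniq_l (undup_uniq _) sub_l.
Qed.

Lemma mass_le_state c N t : mass_le c N -> mass_le (state c t) N.
Proof. by move=> mass_c; elim: t => // t; exact: mass_le_global_rule. Qed.

Lemma topples_again c x v t s : (s < t)%N ->
    topples (state c s) x -> state c t (x - val v) = 0%N ->
  exists2 s', (s < s' < t)%N & topples (state c s') (x - val v).
Proof.
move=> + top_x; elim: t => // t IHt; rewrite ltnS leq_eqVlt.
case/predU1P=> [<- /= empty|lt_st empty].
  by have := global_rule_gt0 v top_x; rewrite empty.
have [top_t|stable_t] := boolP (topples (state c t) (x - val v)).
  by exists t => //; rewrite lt_st ltnSn.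
have empty_t : state c t (x - val v) = 0%N.
  by have := global_rule_ge stable_t; move: empty => /= ->; rewrite leqn0 => /eqP.
have [s' /andP[lt_ss' lt_s't] top_s'] := IHt lt_st empty_t.
by exists s' => //; rewrite lt_ss' ltnW.
Qed.

Lemma grain_source c x t : c x = 0%N -> (0 < state c t x)%N ->
  exists2 s, (s < t)%N & exists v, topples (state c s) (x + val v).
Proof.
move=> cx0; elim: t => [|t IHt]; first by rewrite /= cx0.
have [ct0 /=|/IHt[s lt_st top_s] _] := posnP (state c t x); last first.
  by exists s => //; exact: ltnW.
rewrite global_ruleE ct0 sub0n add0n => received; exists t => //.
have [v top_v|none] := pickP (fun v => topples (state c t) (x + val v)).
  by exists v.
by move: received; rewrite big1 // => v _; rewrite none muln0.
Qed.

Definition laplacian (V : zmodType) (phi : 'rV[int]_d -> V) x : V :=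
  \sum_(v : nbh M) (phi (x - val v) - phi x) *+ distr v.

Definition drift : 'rV[int]_d := \sum_(v : nbh M) val v *+ distr v.

Lemma potential_global_rule (V : zmodType) (phi : 'rV[int]_d -> V) S c :
    (0 < theta M)%N -> uniq S ->
    (forall x, (0 < c x)%N -> x \in S) ->
    (forall x, (0 < global_rule M c x)%N -> x \in S) ->
  potential S phi (global_rule M c) =
    potential S phi c + \sum_(x <- S) laplacian phi x *+ topples c x.
Proof.
rewrite /potential => theta_gt0 uniq_S c_supp Fc_supp.
have received v : \sum_(x <- S) phi x *+ (distr v * topples c (x + val v)%R) =
    \sum_(y <- S) phi (y - val v) *+ distr v *+ topples c y.
  rewrite -[RHS](sumr_translate (v := val v)) // => [|y].
    by apply: eq_bigr => x _; rewrite addrK mulrnA.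
  case: (boolP (topples c y)) => [top_y _|_]; last by rewrite eqxx.
  by split; [apply/c_supp/(leq_trans theta_gt0) | apply/Fc_supp/global_rule_gt0].
under eq_bigr do
  rewrite global_ruleE mulrnDr -sumrMnr mulrnBr ?theta_topples_le // mulrnA.
rewrite big_split sumrB exchange_big /= -addrA; congr (_ + _).
under [X in _ + X]eq_bigr do rewrite received.
rewrite exchange_big addrC -sumrB; apply: eq_bigr => x _ /=.
rewrite -sumrMnl -sumrMnr -sumrMnl -sumrB; apply: eq_bigr => v _.
by rewrite !mulrnBl.
Qed.

Lemma laplacian_additive (V : zmodType) (phi : {additive 'rV[int]_d -> V}) x :
  laplacian phi x = - phi drift.
Proof.
rewrite raddf_sum -sumrN; apply: eq_bigr => v _.
by rewrite raddfB addrC addKr raddfMn mulNrn.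
Qed.

Lemma laplacian_sqnorm x : laplacian (fun y => dot y y) x =
  \sum_(v : nbh M) dot (val v) (val v) *+ distr v - dot x drift *+ 2.
Proof.
rewrite raddf_sum -sumrMnl -sumrB; apply: eq_bigr => v _.
rewrite /= [dot x (_ *+ _)]raddfMn mulrnAC -mulrnBl; congr (_ *+ _).
rewrite dotBr ![dot (_ - _) _]dotC !dotBr [dot (val v) x]dotC; ring.
Qed.

Lemma norm_inf_drift : (norm_inf drift <= theta M * radius M)%N.
Proof.
apply: leq_trans (norm_inf_sum _ _) _; rewrite big_distrl /=.
apply: leq_sum => v _.
by rewrite -scaler_nat norm_infZ natz leq_mul2l radius_ge orbT.
Qed.

Lemma toppling_potential : (0 < theta M)%N ->
  exists2 phi : 'rV[int]_d -> int, forall x, 0 < laplacian phi x &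
    forall x, (`|phi x| <= d * (norm_inf x * (norm_inf x + theta M * radius M)))%N.
Proof.
move=> theta_gt0; have [drift0|drift_neq0] := eqVneq drift 0; last first.
  exists (dot (- drift)) => x.
    by rewrite laplacian_additive /= dotC raddfN opprK dot_gt0.
  apply: leq_trans (dot_norm_inf_le _ _) _; rewrite norm_infN.
  by rewrite leq_mul // mulnC leq_mul // (leq_trans norm_inf_drift) ?leq_addl.
exists (fun y => dot y y) => x; last first.
  by apply: leq_trans (dot_norm_inf_le _ _) _; rewrite !leq_mul ?leq_addr.
rewrite laplacian_sqnorm drift0 raddf0 mul0rn subr0.
have dot_val_gt0 v : 0 < dot (val v) (val v) by exact/dot_gt0/nbh_val_neq0.
apply: (@lt_le_trans _ _ (\sum_(v : nbh M) 1 *+ distr v)).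
  by rewrite sumrMnr natz.
by apply: ler_sum => v _; rewrite lerMn2r -gtz0_ge1 dot_val_gt0 orbT.
Qed.

Section CompleteSandpile.
Hypothesis completeM : complete M.
Hypothesis theta_gt0 : (0 < theta M)%N.

Definition walk_radius : nat := (2 * #|{: nbh M}| * radius M)%N.
Definition shell_width : nat := (radius M + 2 * walk_radius)%N.

Lemma nbh_inhabited : exists v : nbh M, val v != 0.
Proof.
have [v _|none] := pickP {: nbh M}; first by exists v; exact: nbh_val_neq0.
by move: theta_gt0; rewrite /theta big_pred0.
Qed.

Lemma radius_gt0 : (0 < radius M)%N.
Proof.
have [v v_neq0] := nbh_inhabited; apply: leq_trans (radius_ge v).
by rewrite lt0n norm_inf_eq0.
Qed.

Lemma dim_gt0 : (0 < d)%N.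
Proof.
have [v v_neq0] := nbh_inhabited; rewrite lt0n.
apply: contra_neqN v_neq0 => /eqP d0.
by apply/rowP => i; have := ltn_ord i; rewrite {2}d0.
Qed.

Lemma complete_word x : exists s : seq (nbh M), \sum_(v <- s) val v = x.
Proof.
have [a ->] := completeM x; exists (flatten [seq nseq (a v) v | v <- enum {: nbh M}]).
rewrite big_flatten big_map big_enum /=; apply: eq_bigr => v _.
by rewrite big_nseq -Monoid.iteropE.
Qed.

Lemma closed_word : exists2 l : seq (nbh M), (0 < size l)%N & \sum_(v <- l) val v = 0.
Proof.
have [v _] := nbh_inhabited; have [s sum_s] := complete_word (- val v).
by exists (v :: s); rewrite // big_cons sum_s subrr.
Qed.

Lemma grain_near_toppled c x t s : (s < t)%N -> topples (state c s) x ->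
  exists2 y, (norm_inf (y - x)%R <= walk_radius)%N & (0 < state c t y)%N.
Proof.
move=> lt_st top_x; have [l l_neq0 sum_l] := closed_word.
pose near := exists2 y, (norm_inf (y - x)%R <= walk_radius)%N & (0 < state c t y)%N.
have walk i : near \/ exists2 p : seq (nbh M), balanced l p &
    exists2 s', (s + i <= s' < t)%N & topples (state c s') (x - \sum_(v <- p) val v).
  elim: i => [|i [?|[p bal_p [s' s'P top_s']]]]; [right|by left|].
    exists [::]; first exact: balanced_nil.
    by exists s; rewrite ?addn0 ?leqnn // big_nil subr0.
  have [w bal_pw] := balanced_rcons l_neq0 bal_p.
  have end_pw : x - \sum_(v <- rcons p w) val v = x - \sum_(v <- p) val v - val w.
    by rewrite -cats1 big_cat big_seq1 opprD addrA.
  have [empty|grain] := posnP (state c t (x - \sum_(v <- p) val v - val w)).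
    right; exists (rcons p w) => //.
    have [|s'' s''P top_s''] := topples_again _ top_s' empty; first by lia.
    by exists s''; rewrite ?end_pw //; lia.
  left; exists (x - \sum_(v <- p) val v - val w) => //.
  rewrite -end_pw addrC addKr norm_infN.
  exact: (norm_inf_balanced (u := val) l_neq0 radius_ge sum_l bal_pw).
by have [//|[p _ [s' ? _]]] := walk t; lia.
Qed.

Lemma toppled_in_shell c n h x t :
    supported_in_ball n c -> (n <= h)%N ->
    (0 < state c t x)%N -> (h + radius M <= norm_inf x)%N ->
  exists2 z, (h <= norm_inf z < h + radius M)%N &
    exists2 s, (s < t)%N & topples (state c s) z.
Proof.
move=> c_ball le_nh; elim/ltn_ind: t x => t IHt x grain_x far_x.
have cx0 : c x = 0%N.
  by have [//|/c_ball] := posnP (c x); lia.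
have [s lt_st [v top_v]] := grain_source cx0 grain_x.
have far_v : (h <= norm_inf (x + val v)%R)%N.
  have := norm_infD (x + val v) (- val v); rewrite addrK norm_infN.
  by have := radius_ge v; lia.
have [far|near] := leqP (h + radius M)%N (norm_inf (x + val v)); last first.
  by exists (x + val v); rewrite ?far_v //; exists s.
have [|z zP [s' lt_s's top_z]] := IHt s lt_st _ _ far; first exact: leq_trans top_v.
by exists z => //; exists s' => //; exact: ltn_trans lt_st.
Qed.

Lemma grain_in_shell c n h x t :
    supported_in_ball n c -> (n <= h)%N ->
    (0 < state c t x)%N -> (h + radius M <= norm_inf x)%N ->
  exists2 y, (0 < state c t y)%N & (h <= norm_inf y + walk_radius < h + shell_width)%N.
Proof.
move=> c_ball le_nh grain_x far_x.
have [z zP [s lt_st top_z]] := toppled_in_shell c_ball le_nh grain_x far_x.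
have [y near_y grain_y] := grain_near_toppled lt_st top_z; exists y => //.
have := norm_infD (y - z) z; rewrite subrK.
have := norm_infD (- (y - z)) y; rewrite norm_infN opprB subrK.
by rewrite /shell_width; lia.
Qed.

Definition grain_extent (n N : nat) : nat := (n + N * shell_width + radius M)%N.

Lemma norm_inf_grain_lt c n N x t :
    supported_in_ball n c -> mass_le c N -> (0 < state c t x)%N ->
  (norm_inf x < grain_extent n N)%N.
Proof.
move=> c_ball mass_c grain_x; rewrite ltnNge; apply/negP => far_x.
have shell j : (j < N.+1)%N -> exists2 y, (0 < state c t y)%N &
    (n + j * shell_width <= norm_inf y + walk_radius < n + j.+1 * shell_width)%N.
  move=> le_jN; rewrite mulSnr addnA.
  apply: (grain_in_shell c_ball _ grain_x); first exact: leq_addr.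
  by apply: leq_trans far_x; rewrite leq_add2r leq_add2l leq_mul2r -ltnS le_jN orbT.
have [l [uniq_l size_l] /allP lP] := uniq_points_in_shells shell.
suff : (size l <= N)%N by rewrite size_l ltnn.
by apply: size_le_mass (mass_le_state t mass_c) uniq_l _; apply/allP => y /lP /andP[].
Qed.

Lemma potential_stabilization c S (phi : 'rV[int]_d -> int) N G :
    uniq S -> (forall t x, 0 < state c t x -> x \in S)%N -> mass_le c N ->
    (forall x, 0 < laplacian phi x) -> {in S, forall x, `|phi x| <= G}%N ->
  exists2 t, (t <= 2 * N * G)%N & stable M (state c t).
Proof.
move=> uniq_S state_supp mass_c phi_step phi_le.
pose pot t := potential S phi (state c t).
have pot_le t : `|pot t| <= (N * G)%:R.
  apply: normr_potential_le uniq_S (mass_le_state t mass_c) _ => x xS.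
  by rewrite -abszE natz lez_nat phi_le.
have [t stable_t|unstable] :=
    pickP (fun t : 'I_(2 * N * G).+1 => ~~ has (topples (state c t)) S).
  exists t; first by rewrite -ltnS.
  move=> x; rewrite ltnNge; apply: contra stable_t => top_x.
  by apply/hasP; exists x => //; apply: (state_supp t); exact: leq_trans top_x.
have growth t : (t <= (2 * N * G).+1)%N -> pot 0%N + t%:Z <= pot t.
  elim: t => [_|t IHt lt_t]; first by rewrite addr0.
  have -> : pot t.+1 =
      pot t + \sum_(x <- S) laplacian phi x *+ topples (state c t) x.
    apply: potential_global_rule => //; first exact: state_supp.
    exact: (state_supp t.+1).
  rewrite -[t.+1]addn1 PoszD addrA; apply: lerD; first by apply: IHt; exact: ltnW.
  have /negbFE/hasP[y yS top_y] := unstable (Ordinal lt_t).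
  rewrite (big_rem y) //= top_y -gtz0_ge1 ltr_pwDl ?phi_step ?sumr_ge0 // => x _.
  by rewrite mulrn_wge0 ?ltW.
have := growth _ (leqnn _); have := pot_le 0%N; have := pot_le (2 * N * G).+1.
by rewrite !natz; lia.
Qed.

Lemma ball_stabilization c n N :
    supported_in_ball n c -> mass_le c N ->
    let B := grain_extent n N in
  exists2 t, (t <= 2 * N * (d * (B * (B + theta M * radius M))))%N &
    stable M (state c t).
Proof.
move=> c_ball mass_c B; have [phi phi_step phi_le] := toppling_potential theta_gt0.
pose S := [seq x <- cube d (- B%:Z) (2 * B) | norm_inf x < B]%N.
apply: (@potential_stabilization c S phi) => // [|t x grain_x|x].
- by rewrite filter_uniq ?uniq_cube.
- have lt_xB := norm_inf_grain_lt c_ball mass_c grain_x.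
  rewrite mem_filter lt_xB; apply: mem_cube => j.
  by have := leq_ltn_trans (norm_inf_ge x j) lt_xB; lia.
rewrite mem_filter => /andP[/ltnW le_xB _]; apply: leq_trans (phi_le x) _.
by rewrite !leq_mul // leq_add2r.
Qed.

End CompleteSandpile.

End Sandpile.

Lemma supported_on_cube_in_ball d n (c : configuration d) :
  0 < n -> supported_on_cube n c -> supported_in_ball n c.
Proof.
move=> n0 c_supp y cy; rewrite -(prednK n0) ltnS; apply/norm_inf_leP => i.
have /c_supp/(_ i)/andP[ge0 lt_n] : c y <> 0 by lia.
by lia.
Qed.

Lemma mass_le_supported_on_cube d n m (c : configuration d) :
  supported_on_cube n c -> (forall x, c x <= m) -> mass_le c (m * n ^ d).
Proof.
move=> c_supp c_le; rewrite -(size_cube d 0 n); apply: mass_le_bounded => // x cx.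
by apply: mem_cube => j; rewrite add0r; apply: c_supp; lia.
Qed.

Lemma size_factors_le d th r n : 0 < d -> 0 < th -> 0 < r -> 0 < n ->
    let X := 2 * d * th * r * n in
  [/\ 2 * d <= X, 2 * th <= X, 2 * (th * r) <= X & n + r <= X].
Proof.
move=> d_gt0 th_gt0 r_gt0 n_gt0 X.
have factor_le a b : 0 < b -> X = a * b -> a <= X.
  by move=> b_gt0 ->; rewrite leq_pmulr.
have nr_le : n + r <= 2 * (r * n) by move: r_gt0 n_gt0; clear; nia.
split; last apply: leq_trans nr_le _.
- by apply: (factor_le _ (th * r * n)); rewrite ?muln_gt0 ?th_gt0 ?r_gt0 // /X; lia.
- by apply: (factor_le _ (d * r * n)); rewrite ?muln_gt0 ?d_gt0 ?r_gt0 // /X; lia.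
- by apply: (factor_le _ (d * n)); rewrite ?muln_gt0 ?d_gt0 // /X; lia.
by apply: (factor_le _ (d * th)); rewrite ?muln_gt0 ?d_gt0 // /X; lia.
Qed.

Lemma stabilization_time_le_exp d th r n N W B X :
    0 < d -> 0 < n ->
    [/\ 2 * d <= X, 2 * th <= X, 2 * (th * r) <= X & n + r <= X] ->
    N = 2 * th * n ^ d -> r <= W <= 5 * (th * r) -> B = n + N * W + r ->
  2 * N * (d * (B * (B + th * r))) <= X ^ (16 * d ^ 2).
Proof.
move=> d_gt0 n_gt0 [d_le_X th_le_X thr_le_X nr_le_X] defN /andP[r_le_W W_le] defB.
have X_ge2 : 2 <= X by apply: leq_trans d_le_X; rewrite leq_pmulr.
have X_le_X3 : 4 * X <= X ^ 3.
  by rewrite expnSr leq_mul2r (_ : 4 = 2 ^ 2) // leq_exp2r // X_ge2 orbT.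
have N_le : N <= X ^ d.+1.
  by rewrite defN expnS leq_mul // leq_exp2r // (leq_trans _ nr_le_X) ?leq_addr.
have NW_le : N * W <= X ^ (d + 4).
  by rewrite (_ : d + 4 = d.+1 + 3) ?expnD ?leq_mul //; lia.
have B_le : B <= X ^ (d + 5).
  have X_le_exp : X <= X ^ (d + 4) by rewrite -{1}(expn1 X) leq_pexp2l //; lia.
  have : 2 * X ^ (d + 4) <= X ^ (d + 5) by rewrite [d + 5]addnS expnS leq_mul.
  by lia.
have thr_le_B : th * r <= B.
  have th_le_N : th <= N by rewrite defN mulnAC leq_pmull // muln_gt0 expn_gt0 n_gt0.
  by have := leq_mul th_le_N r_le_W; lia.
apply: (@leq_trans (X ^ d.+1 * (X * (X * (X ^ (d + 5) * X ^ (d + 5)))))).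
  apply: (@leq_trans (N * (2 * (2 * d * (B * B))))); last by rewrite !leq_mul.
  rewrite (_ : N * _ = 2 * N * (d * (B * (B + B)))); last by lia.
  by rewrite !leq_mul // leq_add2l.
rewrite -!(expnD, expnS) leq_pexp2l ?(leq_trans _ X_ge2) //.
have : d <= d ^ 2 by rewrite leq_pmulr.
by lia.
Qed.

Theorem theorem1 :
  exists K : nat,
    forall (d : nat) (M : sandpile d), complete M ->
    forall n : nat, 1 <= n ->
    forall c : configuration d,
      supported_on_cube n c ->
      (forall x, c x < 2 * theta M) ->
      exists2 t : nat,
        t <= (2 * d * theta M * radius M * n) ^ (K * d ^ 2) &
        stable M (iter t (global_rule M) c).
Proof.
exists 16 => d M completeM n n_gt0 c c_supp c_lt.
have theta_gt0 : 0 < theta M by have := c_lt 0%R; lia.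
have mass_c : mass_le c (2 * theta M * n ^ d).
  by apply: mass_le_supported_on_cube => // x; exact: ltnW.
have c_ball := supported_on_cube_in_ball n_gt0 c_supp.
have [t le_t stable_t] := ball_stabilization completeM theta_gt0 c_ball mass_c.
have d_gt0 := dim_gt0 theta_gt0; have r_gt0 := radius_gt0 theta_gt0.
have width_le : radius M <= shell_width M <= 5 * (theta M * radius M).
  by rewrite leq_addr /shell_width /walk_radius; have := card_nbh_le M; nia.
exists t => //; apply: leq_trans le_t _.
exact: stabilization_time_le_exp d_gt0 n_gt0
  (size_factors_le d_gt0 theta_gt0 r_gt0 n_gt0) erefl width_le erefl.
Qed.
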